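(* For a nonempty finite set $P = \{p^{(1)},\dots,p^{(m)}\} \subset \mathbb{R}^n/\mathbb{R}\mathbf{1}$, the set $\overline{P}$ of all tropical Fréchet means of $P$ is a polytrope in $\mathbb{R}^n/\mathbb{R}\mathbf{1} \cong \mathbb{R}^{n-1}$. In particular, $\overline{P}$ is bounded in $\mathbb{R}^n/\mathbb{R}\mathbf{1}$.
   Context: $\mathbf{1}=(1,\dots,1)$. The tropical projective torus $\mathbb{R}^n/\mathbb{R}\mathbf{1}$ is the quotient of $\mathbb{R}^n$ in which two vectors are identified if they differ by a real multiple of $\mathbf{1}$; it is identified with $\mathbb{R}^{n-1}$ (e.g. via $x\mapsto (x_2-x_1,\dots,x_n-x_1)$). The tropical metric on it is $d_{\mathrm{tr}}(x,y)=\max_{1\le i\le n}(x_i-y_i)-\min_{1\le i\le n}(x_i-y_i)$. A tropical Fréchet mean of $P=\{p^{(1)},\dots,p^{(m)}\}$ is a point $\widetilde{x}\in\mathbb{R}^n/\mathbb{R}\mathbf{1}$ minimizing $c(x)=\sum_{\nu=1}^m d_{\mathrm{tr}}(x,p^{(\nu)})^2$ over $x\in\mathbb{R}^n/\mathbb{R}\mathbf{1}$. A tropical polytope is a set of the form $\mathrm{tconv}(a_1,\dots,a_k)=\{\bigoplus_{j=1}^k \lambda_j\odot a_j : \lambda_j\in\mathbb{R}\}\subset \mathbb{R}^n/\mathbb{R}\mathbf{1}$, where $x\oplus y$ is the coordinatewise maximum and $\lambda\odot x=(\lambda+x_1,\dots,\lambda+x_n)$. A classical polytope is the convex hull of finitely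 many points. A polytrope is a tropical polytope that is also a classical polytope (under $\mathbb{R}^n/\mathbb{R}\mathbf{1}\cong\mathbb{R}^{n-1}$). *)

(* Defs.v *)
From HB Require Import structures.
From mathcomp Require Import all_boot all_order all_algebra generic_quotient.
From mathcomp Require Import finmap.
From mathcomp Require Import all_classical all_reals.

Set Implicit Arguments.
Unset Strict Implicit.
Unset Printing Implicit Defensive.

Import Order.TTheory GRing.Theory Num.Theory.

Local Open Scope classical_set_scope.
Local Open Scope ring_scope.
Local Open Scope quotient_scope.

(* The ambient space is R^(n+1), so that it has at least one coordinate, and
   the torus R^(n+1)/R1 has dimension n. *)

Definition eqv1 (R : realType) (n : nat) : rel 'rV[R]_n.+1 :=
  fun v w => `[< exists c : R, v - w = c *: const_mx 1 >].

Lemma eqv1_refl (R : realType) (n : nat) : reflexive (@eqv1 R n).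
Proof. by move=> v; apply/asboolP; exists 0; rewrite subrr scale0r. Qed.

Lemma eqv1_sym (R : realType) (n : nat) : symmetric (@eqv1 R n).
Proof.
move=> v w; apply/idP/idP => /asboolP[c e]; apply/asboolP; exists (- c);
  by rewrite scaleNr -e opprB.
Qed.

Lemma eqv1_trans (R : realType) (n : nat) : transitive (@eqv1 R n).
Proof.
move=> w v u /asboolP[c e] /asboolP[d f]; apply/asboolP; exists (c + d).
by rewrite scalerDl -e -f addrA subrK.
Qed.

Canonical eqv1_equiv (R : realType) (n : nat) :=
  EquivRel (@eqv1 R n) (@eqv1_refl R n) (@eqv1_sym R n) (@eqv1_trans R n).

Definition torus (R : realType) (n : nat) : Type := {eq_quot (@eqv1 R n)}.

HB.instance Definition _ (R : realType) (n : nat) := Choice.on (torus R n).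
HB.instance Definition _ (R : realType) (n : nat) := EqQuotient.on (torus R n).

Definition max_coord (R : realType) (n : nat) (v : 'rV[R]_n.+1) : R :=
  \big[Num.max/v 0 ord0]_(i < n.+1) v 0 i.

Definition min_coord (R : realType) (n : nat) (v : 'rV[R]_n.+1) : R :=
  \big[Num.min/v 0 ord0]_(i < n.+1) v 0 i.

Definition dtr_vec (R : realType) (n : nat) (v w : 'rV[R]_n.+1) : R :=
  max_coord (v - w) - min_coord (v - w).

(* Independence of the representatives is [dtr_pi] below. *)
Definition dtr (R : realType) (n : nat) (x y : torus R n) : R :=
  dtr_vec (repr x) (repr y).

Definition frechet_cost (R : realType) (n : nat) (P : {fset torus R n})
    (x : torus R n) : R :=
  \sum_(p <- P) dtr x p ^+ 2.

Definition frechet_means (R : realType) (n : nat) (P : {fset torus R n}) :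
    set (torus R n) :=
  [set x | forall y, frechet_cost P x <= frechet_cost P y].

Definition trop_add (R : realType) (n : nat) (v w : 'rV[R]_n) : 'rV[R]_n :=
  \row_i Num.max (v 0 i) (w 0 i).

Definition trop_scale (R : realType) (n : nat) (c : R) (v : 'rV[R]_n) :
    'rV[R]_n :=
  \row_i (c + v 0 i).

(* [trop_add] has no neutral element over R, so the iteration starts from the
   first term; this is harmless because [trop_add] is idempotent. *)
Definition trop_comb (R : realType) (n k : nat) (l : 'I_k.+1 -> R)
    (a : 'I_k.+1 -> 'rV[R]_n) : 'rV[R]_n :=
  \big[@trop_add R n/trop_scale (l ord0) (a ord0)]_(j < k.+1)
    trop_scale (l j) (a j).

(* The generators are given by representatives; changing them only shifts the
   coefficients [l], see [tconv_eqv]. *)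
Definition tconv (R : realType) (n k : nat) (a : 'I_k.+1 -> 'rV[R]_n.+1) :
    set (torus R n) :=
  [set x | exists l : 'I_k.+1 -> R, x = \pi_(torus R n) (trop_comb l a)].

Definition tropical_polytope (R : realType) (n : nat) (S : set (torus R n)) :
    Prop :=
  exists (k : nat) (a : 'I_k.+1 -> 'rV[R]_n.+1), S = tconv a.

(* The identification of the torus with R^n given by
   x |-> (x_1 - x_0, ..., x_n - x_0); see [torus_coord_pi] and
   [torus_coord_bij]. *)
Definition torus_coord (R : realType) (n : nat) (x : torus R n) : 'rV[R]_n :=
  \row_i (repr x 0 (lift ord0 i) - repr x 0 ord0).

Definition conv_hull (R : realType) (n k : nat) (q : 'I_k -> 'rV[R]_n) :
    set 'rV[R]_n :=
  [set v | exists w : 'I_k -> R,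
    [/\ forall j, 0 <= w j, \sum_j w j = 1 & v = \sum_j w j *: q j]].

Definition classical_polytope (R : realType) (n : nat) (S : set 'rV[R]_n) :
    Prop :=
  exists (k : nat) (q : 'I_k -> 'rV[R]_n), S = conv_hull q.

Definition polytrope (R : realType) (n : nat) (S : set (torus R n)) : Prop :=
  tropical_polytope S /\ classical_polytope (@torus_coord R n @` S).

Definition dtr_bounded (R : realType) (n : nat) (S : set (torus R n)) : Prop :=
  exists M : R, forall x y, S x -> S y -> dtr x y <= M.

Lemma torus_piP (R : realType) (n : nat) (v w : 'rV[R]_n.+1) :
  \pi_(torus R n) v = \pi_(torus R n) w <-> exists c : R, v = trop_scale c w.
Proof.
split=> [/eqmodP/asboolP[c e]|[c ->]].
  exists c; apply/rowP => i.
  by have /rowP/(_ i) := e; rewrite !mxE mulr1 => <-; rewrite subrK.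
apply/eqmodP/asboolP; exists c; apply/rowP => i.
by rewrite !mxE mulr1 addrK.
Qed.

Lemma torus_repr_pi (R : realType) (n : nat) (v : 'rV[R]_n.+1) :
  exists c : R, repr (\pi_(torus R n) v) = trop_scale c v.
Proof. by apply/torus_piP; rewrite reprK. Qed.

Lemma max_coord_scale (R : realType) (n : nat) (c : R) (v : 'rV[R]_n.+1) :
  max_coord (trop_scale c v) = c + max_coord v.
Proof.
rewrite /max_coord mxE.
under eq_bigr do rewrite mxE.
apply/esym/(big_morph (fun x => c + x)) => // x y.
by rewrite addr_maxr.
Qed.

Lemma min_coord_scale (R : realType) (n : nat) (c : R) (v : 'rV[R]_n.+1) :
  min_coord (trop_scale c v) = c + min_coord v.
Proof.
rewrite /min_coord mxE.
under eq_bigr do rewrite mxE.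
apply/esym/(big_morph (fun x => c + x)) => // x y.
by rewrite addr_minr.
Qed.

Lemma dtr_pi (R : realType) (n : nat) (v w : 'rV[R]_n.+1) :
  dtr (\pi_(torus R n) v) (\pi_(torus R n) w) = dtr_vec v w.
Proof.
rewrite /dtr; have [c ->] := torus_repr_pi v; have [d ->] := torus_repr_pi w.
rewrite /dtr_vec.
have -> : trop_scale c v - trop_scale d w = trop_scale (c - d) (v - w).
  by apply/rowP => i; rewrite !mxE opprD addrACA.
by rewrite max_coord_scale min_coord_scale opprD addrACA subrr add0r.
Qed.

Lemma trop_scaleA (R : realType) (n : nat) (c d : R) (v : 'rV[R]_n) :
  trop_scale c (trop_scale d v) = trop_scale (c + d) v.
Proof. by apply/rowP => i; rewrite !mxE addrA. Qed.

Lemma tconv_eqv (R : realType) (n k : nat) (a b : 'I_k.+1 -> 'rV[R]_n.+1) :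
  (forall j, \pi_(torus R n) (a j) = \pi_(torus R n) (b j)) ->
  tconv a = tconv b.
Proof.
suff sub (a' b' : 'I_k.+1 -> 'rV[R]_n.+1) :
    (forall j, \pi_(torus R n) (a' j) = \pi_(torus R n) (b' j)) ->
    tconv a' `<=` tconv b'.
  by move=> e; apply/seteqP; split; apply: sub => j; rewrite e.
move=> e x [l ->].
have /boolp.choice[c ec] j := (torus_piP (a' j) (b' j)).1 (e j).
exists (fun j => l j + c j); congr (\pi_(torus R n) _).
rewrite /trop_comb ec trop_scaleA.
by apply: eq_bigr => j _; rewrite ec trop_scaleA.
Qed.

Lemma torus_coord_pi (R : realType) (n : nat) (v : 'rV[R]_n.+1) :
  torus_coord (\pi_(torus R n) v) = \row_i (v 0 (lift ord0 i) - v 0 ord0).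
Proof.
apply/rowP => i; rewrite !mxE; have [c ->] := torus_repr_pi v.
by rewrite !mxE opprD addrACA subrr add0r.
Qed.

Lemma torus_coord_bij (R : realType) (n : nat) : bijective (@torus_coord R n).
Proof.
exists (fun u : 'rV[R]_n =>
          \pi_(torus R n) (\row_i oapp (u 0) 0 (unlift ord0 i))) => [x|u].
  rewrite -[RHS]reprK; apply/torus_piP; exists (- repr x 0 ord0).
  apply/rowP => i; rewrite !mxE; case: unliftP => [j ->|->] /=.
    by rewrite mxE addrC.
  by rewrite addNr.
rewrite torus_coord_pi; apply/rowP => i.
by rewrite !mxE liftK unlift_none subr0.
Qed.

(* Main.v *)
Require Import Defs.
From HB Require Import structures.
From mathcomp Require Import all_boot all_order all_algebra generic_quotient.
From mathcomp Require Import finmap.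
From mathcomp Require Import all_classical all_reals all_analysis lra.

Set Implicit Arguments.
Unset Strict Implicit.
Unset Printing Implicit Defensive.

Import Order.TTheory GRing.Theory Num.Theory.
Import numFieldNormedType.Exports.

Local Open Scope classical_set_scope.
Local Open Scope ring_scope.
Local Open Scope quotient_scope.

(** A Frechet mean exists because the cost is continuous and, off a compact box
    around a sample point [p], already larger than its value at [p]
    ([frechet_means_neq0]).

    Each distance [dtr _ p] is convex and the square is strictly convex, so two
    minimizers [x] and [y] must have the same distance to every sample point:
    otherwise their midpoint would be strictly cheaper
    ([frechet_means_equidistant]). A point at most as far from every sample
    point as some minimizer is a minimizer too. Hence the set of means is
    an intersection of tropical balls, one around each sample point.

    A tropical ball is cut out by inequalities [y_i - y_j <= p_i - p_j + r],
    so the set of means has the form [y_i - y_j <= w i j] for all [i], [j], with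
    finite bounds [w i j] ([balls_digraph_polyhedron]). Such a set, once
    nonempty, is a polytrope for two separate reasons.
    - It is a tropical polytope: for each [j], normalize its points by
      [y_j = 0] and take their coordinatewise infimum [a j]. Then [a j] is in
      the set, and a point [x] of the set is the tropical combination of the
      [a j] with coefficients [x_j], since [x_j + a j i <= x_i] with equality
      at [j = i] ([digraph_polyhedron_tropical_polytope]).
    - It is a classical polytope: all differences of coordinates are bounded, so
      it is a polyhedron without recession directions, and such a polyhedron is
      the convex hull of finitely many points
      ([polyhedron_classical_polytope]). *)

(** * Polyhedra without recession directions are convex hulls *)

Lemma conv_hull_point (R : realType) (n k : nat) (q : 'I_k -> 'rV[R]_n)
    (j : 'I_k) :
  conv_hull q (q j).
Proof.
exists (fun i => (i == j)%:R); split=> [i||]; first exact: ler0n.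
  by rewrite (bigD1 j) //= eqxx big1 ?addr0 // => i /negbTE->.
rewrite (bigD1 j) //= eqxx scale1r big1 ?addr0 // => i /negbTE->.
by rewrite scale0r.
Qed.

Lemma conv_hull_segment (R : realType) (n k : nat) (q : 'I_k -> 'rV[R]_n)
    (u v : 'rV[R]_n) (s t : R) :
    conv_hull q u -> conv_hull q v -> 0 <= s -> 0 <= t -> s + t = 1 ->
  conv_hull q (s *: u + t *: v).
Proof.
move=> [a [a0 a1 ->]] [b [b0 b1 ->]] s0 t0 st1.
exists (fun j => s * a j + t * b j); split=> [j||].
- by rewrite addr_ge0 ?mulr_ge0.
- by rewrite big_split /= -!mulr_sumr a1 b1 !mulr1.
- rewrite !scaler_sumr -big_split /=; apply: eq_bigr => j _.
  by rewrite scalerDl !scalerA.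
Qed.

Lemma conv_hull_halfspace (R : realType) (n k : nat) (q : 'I_k -> 'rV[R]_n)
    (f : {scalar 'rV[R]_n}) (b : R) (u : 'rV[R]_n) :
  (forall j, f (q j) <= b) -> conv_hull q u -> f u <= b.
Proof.
move=> fq [w [w0 w1 ->]]; rewrite linear_sum /=.
under eq_bigr do rewrite scalarZ.
rewrite -[leRHS]mul1r -w1 mulr_suml; apply: ler_sum => j _.
exact: ler_wpM2l.
Qed.

Definition polyhedron (R : realType) (n : nat) (I : finType)
    (f : I -> {scalar 'rV[R]_n}) (b : I -> R) : set 'rV[R]_n :=
  [set u | forall k, f k u <= b k].

Definition tight (R : realType) (n : nat) (I : finType)
    (f : I -> {scalar 'rV[R]_n}) (b : I -> R) (u : 'rV[R]_n) : {set I} :=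
  [set k | f k u == b k]%SET.

(** Along [d], the constraints tight at [u] stay tight; the ray leaves the
    polyhedron at the first time at which one of the other constraints,
    necessarily slack at [u], becomes tight. *)
Lemma ray_hits_facet (R : realType) (n : nat) (I : finType)
    (f : I -> {scalar 'rV[R]_n}) (b : I -> R) (u d : 'rV[R]_n) :
    polyhedron f b u -> (forall k, k \in tight f b u -> f k d = 0) ->
    (exists k, 0 < f k d) ->
  exists2 t : R, 0 < t &
    polyhedron f b (u + t *: d) /\ tight f b u \proper tight f b (u + t *: d).
Proof.
move=> Pu ud0 [k0 k0d].
pose time k := (b k - f k u) / f k d.
case: (@arg_minP _ R I k0 (fun k => 0 < f k d) time k0d) => k kd kmin.
have fE t i : f i (u + t *: d) = f i u + t * f i d.
  by rewrite linearD /= scalarZ.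
have ku : k \notin tight f b u.
  by apply/negP => /ud0 e; rewrite e ltxx in kd.
have t0 : 0 < time k.
  rewrite divr_gt0 // subr_gt0 lt_neqAle Pu andbT.
  by move: ku; rewrite inE.
exists (time k) => //; split.
  move=> i; rewrite fE; case: (ltP 0 (f i d)) => [id|id].
    have := kmin i id; rewrite {2}/time ler_pdivlMr // => h.
    by rewrite addrC -lerBrDr.
  by rewrite (le_trans _ (Pu i)) // gerDl mulr_ge0_le0 // ltW.
apply/properP; split.
  apply/fintype.subsetP => i iu; rewrite inE fE (ud0 _ iu) mulr0 addr0.
  by move: iu; rewrite inE.
exists k => //; rewrite inE fE /time divfK ?lt0r_neq0 //.
by rewrite addrC subrK.
Qed.

(** Minkowski's theorem, with the hypothesis on [d] saying that the recession
    cone is trivial. The candidates for vertices are the values [q T], one point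
    with tight set exactly [T] for each [T] for which there is one. A point [u]
    with tight set [T] either equals [q T], or the line through [u] and [q T]
    leaves the polyhedron on both sides of [u] at points with strictly more
    tight constraints, of which [u] is a convex combination. The induction is on
    the number of slack constraints. *)
Lemma polyhedron_classical_polytope (R : realType) (n : nat) (I : finType)
    (f : I -> {scalar 'rV[R]_n}) (b : I -> R) :
    (forall d, d != 0 -> exists k, 0 < f k d) ->
  classical_polytope (polyhedron f b).
Proof.
move=> frec; have [[u0 Pu0]|P0] := pselect (exists u, polyhedron f b u);
  last first.
  exists 0%N, (fun _ => 0); apply/seteqP; split=> u.
    by move=> Pu; case: P0; exists u.
  by move=> [w [_ /eqP]]; rewrite big_ord0 eq_sym oner_eq0.
have /boolp.choice[q qP] (T : {set I}) : exists v, polyhedron f b v /\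
    forall u, polyhedron f b u -> tight f b u = T -> tight f b v = T.
  have [[v [Pv vT]]|no] := pselect
      (exists v, polyhedron f b v /\ tight f b v = T).
    by exists v.
  by exists u0; split=> // u Pu uT; case: no; exists u.
pose c (j : 'I_#|{set I}|) := q (enum_val j).
exists #|{set I}|, c.
apply/seteqP; split=> [u Pu|u hu k]; last first.
  by apply: conv_hull_halfspace hu => j; have [+ _] := qP (enum_val j); apply.
have [m] := ubnP #|~: tight f b u|.
elim: m u Pu => // m IH u Pu; rewrite ltnS => um.
have [Pv /(_ u Pu erefl) vu] := qP (tight f b u); set v := q _ in Pv vu.
have hv : conv_hull c v.
  have := conv_hull_point c (enum_rank (tight f b u)).
  by rewrite /c enum_rankK.
(* [u] and [v] have the same tight set, so moving along [v - u] in either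
   direction keeps the tight constraints of [u] tight. *)
have [->//|uv] := eqVneq u v.
have step d : d != 0 -> (forall k, k \in tight f b u -> f k d = 0) ->
    exists2 t, 0 < t & conv_hull c (u + t *: d).
  move=> d0 ud; have [t t0 [Pt ut]] := ray_hits_facet Pu ud (frec d d0).
  exists t => //; apply: IH => //; apply: leq_trans um.
  by rewrite proper_card // properC.
have uv0 k : k \in tight f b u -> f k (v - u) = 0.
  move=> ku; have : k \in tight f b v by rewrite vu.
  by rewrite linearB /=; move: ku; rewrite !inE => /eqP-> /eqP->; rewrite subrr.
have [|s s0 hs] := step (v - u) _ uv0; first by rewrite subr_eq0 eq_sym.
have [||t t0 ht] := step (u - v); first by rewrite subr_eq0.
  by move=> k /uv0; rewrite !linearB /= => /eqP; rewrite subr_eq0 => /eqP->;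
     rewrite subrr.
have st0 : s + t != 0 by rewrite lt0r_neq0 // addr_gt0.
(* The opposite displacements [s] and [t] cancel with weights [t] and [s]. *)
have -> : u = (t / (s + t)) *: (u + s *: (v - u)) +
              (s / (s + t)) *: (u + t *: (u - v)).
  rewrite -(opprB v u) (scalerDr (t / _)) (scalerDr (s / _)) addrACA.
  rewrite -scalerDl -mulrDl (addrC t) divff // scale1r !scalerN !scalerA.
  by rewrite mulrAC (mulrAC s) (mulrC t) subrr addr0.
apply: conv_hull_segment => //; rewrite ?divr_ge0 ?addr_ge0 ?ltW //.
by rewrite -mulrDl (addrC t) divff.
Qed.

(** * Weighted digraph polyhedra in the torus *)

Definition digraph_polyhedron (R : realType) (n : nat)
    (w : 'I_n.+1 -> 'I_n.+1 -> R) : set (torus R n) :=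
  [set x : torus R n | forall i j, repr x 0 i - repr x 0 j <= w i j].

Lemma digraph_polyhedron_pi (R : realType) (n : nat)
    (w : 'I_n.+1 -> 'I_n.+1 -> R) (v : 'rV[R]_n.+1) :
  digraph_polyhedron w (\pi_(torus R n) v) <->
  forall i j, v 0 i - v 0 j <= w i j.
Proof.
rewrite /digraph_polyhedron /=; have [c ->] := torus_repr_pi v.
by split=> vw i j; have := vw i j; rewrite !mxE opprD addrACA subrr add0r.
Qed.

Lemma trop_combE (R : realType) (n k : nat) (l : 'I_k.+1 -> R)
    (a : 'I_k.+1 -> 'rV[R]_n) (i : 'I_n) :
  trop_comb l a 0 i =
  \big[Num.max/l ord0 + a ord0 0 i]_(j < k.+1) (l j + a j 0 i).
Proof.
rewrite /trop_comb (big_morph (fun v : 'rV[R]_n => v 0 i)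
  (id1 := l ord0 + a ord0 0 i) (op1 := Num.max)) => [|u v|]; rewrite ?mxE //.
by apply: eq_bigr => j _; rewrite mxE.
Qed.

(** The constraints [v_i - v_j <= w i j] are preserved by coordinatewise maxima
    and by adding constants. *)
Lemma tconv_sub_digraph_polyhedron (R : realType) (n k : nat)
    (w : 'I_n.+1 -> 'I_n.+1 -> R) (a : 'I_k.+1 -> 'rV[R]_n.+1) :
    (forall m i j, a m 0 i - a m 0 j <= w i j) ->
  tconv a `<=` digraph_polyhedron w.
Proof.
move=> aw _ [l ->]; apply/digraph_polyhedron_pi => i j.
rewrite lerBlDr !trop_combE.
have term m : l m + a m 0 i <=
    w i j + \big[Num.max/l ord0 + a ord0 0 j]_(m < k.+1) (l m + a m 0 j).
have := le_bigmax (l ord0 + a ord0 0 j) (fun m => l m + a m 0 j) m.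
  by have := aw m i j; lra.
by apply: bigmax_le => [|m _]; exact: term.
Qed.

(** The generator [a j] is the least point of the set with [j]-th coordinate
    [0]. Its coordinate [i] is minus the length of a shortest path from [j] to
    [i] in the digraph with edge lengths [w], but the infimum over the set
    avoids paths altogether. *)
Lemma digraph_polyhedron_tropical_polytope (R : realType) (n : nat)
    (w : 'I_n.+1 -> 'I_n.+1 -> R) :
  digraph_polyhedron w !=set0 -> tropical_polytope (digraph_polyhedron w).
Proof.
move=> [x0 x0w].
pose E j i := [set repr x 0 i - repr x 0 j | x in digraph_polyhedron w].
have E_ge x i j : digraph_polyhedron w x ->
    inf (E j i) <= repr x 0 i - repr x 0 j.
  move=> xw; apply: ge_inf; last by exists x.
  by exists (- w j i) => _ [y yw <-]; rewrite lerNl opprB.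
have E_inf i j c :
    (forall x, digraph_polyhedron w x -> c <= repr x 0 i - repr x 0 j) ->
    c <= inf (E j i).
  move=> h; apply: lb_le_inf; first by exists (repr x0 0 i - repr x0 0 j), x0.
  by move=> _ [y yw <-]; exact: h.
pose a (j : 'I_n.+1) : 'rV[R]_n.+1 := \row_i inf (E j i).
(* The infimum [a m] inherits the constraints: they let one bound
   [a m i - w i j] by [x_i - x_m - w i j <= x_j - x_m] for every [x]. *)
have aw m i j : a m 0 i - a m 0 j <= w i j.
  rewrite !mxE lerBlDr -lerBlDl; apply: E_inf => x xw.
  by have := E_ge x i m xw; have := xw i j; lra.
exists n, a; apply/seteqP; split; last exact: tconv_sub_digraph_polyhedron.
move=> x xw; exists (repr x 0).
rewrite -[LHS]reprK; congr (\pi_(torus R n) _); apply/rowP => i.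
rewrite trop_combE; apply/eqP; rewrite eq_le; apply/andP; split.
  (* The term of index [i] already reaches [x_i], because [a i i = 0]. *)
  apply: le_trans (le_bigmax _ _ i) => /=; rewrite mxE lerDl.
  by apply: E_inf => y _; rewrite subrr.
have le_x j : repr x 0 j + a j 0 i <= repr x 0 i.
  by rewrite mxE -lerBrDl; exact: E_ge.
by apply: bigmax_le => [|j _]; exact: le_x.
Qed.

Definition affine_lift (R : realType) (n : nat) (u : 'rV[R]_n) :
    'rV[R]_n.+1 :=
  \row_i oapp (u 0) 0 (unlift ord0 i).

Lemma affine_lift0 (R : realType) (n : nat) (u : 'rV[R]_n) :
  affine_lift u 0 ord0 = 0.
Proof. by rewrite mxE unlift_none. Qed.

Lemma affine_lift_lift (R : realType) (n : nat) (u : 'rV[R]_n) (i : 'I_n) :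
  affine_lift u 0 (lift ord0 i) = u 0 i.
Proof. by rewrite mxE liftK. Qed.

Lemma affine_liftK (R : realType) (n : nat) (u : 'rV[R]_n) :
  torus_coord (\pi_(torus R n) (affine_lift u)) = u.
Proof.
rewrite torus_coord_pi; apply/rowP => i.
by rewrite mxE affine_lift_lift affine_lift0 subr0.
Qed.

Lemma affine_lift_coord (R : realType) (n : nat) (x : torus R n) i :
  affine_lift (torus_coord x) 0 i = repr x 0 i - repr x 0 ord0.
Proof.
by case: (unliftP ord0 i) => [j|] ->;
  rewrite ?affine_lift_lift ?affine_lift0 ?subrr // mxE.
Qed.

Definition edge_form (R : realType) (n : nat) (e : 'I_n.+1 * 'I_n.+1)
    (u : 'rV[R]_n) : R :=
  affine_lift u 0 e.1 - affine_lift u 0 e.2.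

Fact edge_form_scalar (R : realType) (n : nat) (e : 'I_n.+1 * 'I_n.+1) :
  scalar (@edge_form R n e).
Proof.
move=> c u v; have lin i :
    affine_lift (c *: u + v) 0 i = c * affine_lift u 0 i + affine_lift v 0 i.
  case: (unliftP ord0 i) => [j|] ->; rewrite ?affine_lift_lift ?affine_lift0.
    by rewrite !mxE.
  by rewrite mulr0 addr0.
by rewrite /edge_form !lin; lra.
Qed.

HB.instance Definition _ (R : realType) (n : nat) (e : 'I_n.+1 * 'I_n.+1) :=
  GRing.isLinear.Build R 'rV[R]_n R *%R (@edge_form R n e)
    (@edge_form_scalar R n e).

(** Every nonzero [d] increases along some [edge_form]: compare a nonzero
    coordinate with the coordinate [0] of the lift, in the right order. *)
Lemma digraph_polyhedron_classical_polytope (R : realType) (n : nat)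
    (w : 'I_n.+1 -> 'I_n.+1 -> R) :
  classical_polytope (@torus_coord R n @` digraph_polyhedron w).
Proof.
have -> : @torus_coord R n @` digraph_polyhedron w =
    polyhedron (fun e => @edge_form R n e) (fun e => w e.1 e.2).
  apply/seteqP; split=> [_ [x xw <-] e|u uw].
    by rewrite /= /edge_form !affine_lift_coord opprB addrA subrK.
  exists (\pi_(torus R n) (affine_lift u)); last exact: affine_liftK.
  by apply/digraph_polyhedron_pi => i j; exact: (uw (i, j)).
apply: polyhedron_classical_polytope => d.
have [d0 /eqP[]|] := pselect (forall i, d 0 i = 0).
  by apply/rowP => i; rewrite d0 mxE.
move=> /existsNP[i /eqP]; rewrite neq_lt => /orP[] di _.
  exists (ord0, lift ord0 i).
  by rewrite /= /edge_form affine_lift0 affine_lift_lift sub0r oppr_gt0.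
exists (lift ord0 i, ord0).
by rewrite /= /edge_form affine_lift0 affine_lift_lift subr0.
Qed.

(** * The cost function and its minimizers *)

(** This makes tropical balls polyhedra: a maximum minus a minimum is at most
    [r] as soon as all differences of two entries are. *)
Lemma dtr_vec_le (R : realType) (n : nat) (v u : 'rV[R]_n.+1) (r : R) :
  dtr_vec v u <= r <->
  forall i j, (v 0 i - v 0 j) - (u 0 i - u 0 j) <= r.
Proof.
rewrite /dtr_vec /max_coord /min_coord; set d := v - u.
have dE i j : d 0 i - d 0 j = (v 0 i - v 0 j) - (u 0 i - u 0 j).
  by rewrite !mxE; lra.
split=> [vu i j|vu].
  rewrite -dE; have := le_bigmax (d 0 ord0) (d 0) i.
  by have := bigmin_le (d 0 ord0) j (d 0); lra.
have d_le i : d 0 i <= r + \big[Num.min/d 0 ord0]_(j < n.+1) d 0 j.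
  rewrite -lerBlDl; apply: le_bigmin => [|j _];
    by rewrite lerBlDl -lerBlDr dE.
by rewrite lerBlDr; apply: bigmax_le.
Qed.

Lemma dtr_le (R : realType) (n : nat) (x y : torus R n) (r : R) :
  dtr x y <= r <->
  forall i j,
    (repr x 0 i - repr x 0 j) - (repr y 0 i - repr y 0 j) <= r.
Proof. exact: dtr_vec_le. Qed.

Lemma dtr_ge0 (R : realType) (n : nat) (x y : torus R n) : 0 <= dtr x y.
Proof.
have /(_ ord0 ord0) := (dtr_le x y (dtr x y)).1 (lexx _).
by rewrite !subrr.
Qed.

Lemma dtr_pil (R : realType) (n : nat) (v : 'rV[R]_n.+1) (p : torus R n) :
  dtr (\pi_(torus R n) v) p = dtr_vec v (repr p).
Proof. by rewrite -{1}[p]reprK dtr_pi. Qed.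

Lemma dtr_midpoint (R : realType) (n : nat) (x y p : torus R n) :
  dtr (\pi_(torus R n) (2^-1 *: (repr x + repr y))) p <=
  (dtr x p + dtr y p) / 2.
Proof.
rewrite dtr_pil; apply/dtr_vec_le => i j; rewrite !mxE.
have /(_ i j) := (dtr_le x p _).1 (lexx _).
have /(_ i j) := (dtr_le y p _).1 (lexx _).
lra.
Qed.

(** Averaging [dtr x q] and [dtr y q] bounds the distance from the midpoint, and
    the parallelogram identity then shows that the midpoint beats the common
    minimal cost by a quarter of the sum of the squares
    [(dtr x q - dtr y q) ^+ 2], which must therefore vanish. *)
Lemma frechet_means_equidistant (R : realType) (n : nat)
    (P : {fset torus R n}) (x y p : torus R n) :
    frechet_means P x -> frechet_means P y -> p \in P ->
  dtr x p = dtr y p.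
Proof.
move=> xmin ymin pP.
set z := \pi_(torus R n) (2^-1 *: (repr x + repr y)).
have parallelogram :
    \sum_(q <- P) (dtr x q - dtr y q) ^+ 2 + 4 * frechet_cost P z <=
    2 * frechet_cost P x + 2 * frechet_cost P y.
  rewrite /frechet_cost !mulr_sumr -!big_split /=; apply: ler_sum => q _.
  have := dtr_midpoint x y q; have := dtr_ge0 z q; rewrite -/z.
  move: (dtr x q) (dtr y q) (dtr z q) => a b c c0 cab.
  have : c ^+ 2 <= ((a + b) / 2) ^+ 2 by rewrite lerXn2r ?nnegrE //; lra.
  by rewrite !expr2; lra.
have sum0 : \sum_(q <- P) (dtr x q - dtr y q) ^+ 2 == 0.
  rewrite eq_le sumr_ge0 ?andbT => [|q _]; last exact: sqr_ge0.
  by have := xmin z; have := ymin z; lra.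
move: sum0; rewrite psumr_eq0 => [|q _]; last exact: sqr_ge0.
by move=> /allP/(_ p pP); rewrite /= sqrf_eq0 subr_eq0 => /eqP.
Qed.

Lemma frechet_means_balls (R : realType) (n : nat) (P : {fset torus R n})
    (x : torus R n) :
    frechet_means P x ->
  frechet_means P = [set y | forall p, p \in P -> dtr y p <= dtr x p].
Proof.
move=> xmin; apply/seteqP; split=> y.
  by move=> ymin p pP; rewrite (frechet_means_equidistant ymin xmin pP).
move=> yx z; apply: le_trans (xmin z).
rewrite /frechet_cost big_seq [leRHS]big_seq; apply: ler_sum => p pP.
by rewrite lerXn2r ?nnegrE ?dtr_ge0 // yx.
Qed.

(** Balls around different centres bound the same differences of coordinates, so
    only the smallest bound for each pair [i], [j] matters. *)
Lemma balls_digraph_polyhedron (R : realType) (n : nat)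
    (P : {fset torus R n}) (r : torus R n -> R) :
    P <> fset0 ->
  exists w : 'I_n.+1 -> 'I_n.+1 -> R,
    [set y | forall p, p \in P -> dtr y p <= r p] = digraph_polyhedron w.
Proof.
move=> /eqP/fset0Pn[p0 p0P].
pose h i j (p : torus R n) := repr p 0 i - repr p 0 j + r p.
exists (fun i j => \big[Num.min/h i j p0]_(p : P) h i j (val p)).
apply/seteqP; split=> y yP.
  have yh i j p : p \in P -> repr y 0 i - repr y 0 j <= h i j p.
    by move=> pP; have /dtr_le/(_ i j) := yP p pP; rewrite /h; lra.
  by move=> i j; apply: le_bigmin => [|p _]; apply: yh => //; exact: valP.
move=> p pP; apply/dtr_le => i j.
have := bigmin_le (h i j p0) [` pP]%fset (fun p : P => h i j (val p)).
by have := yP i j; rewrite /h /=; lra.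
Qed.

Lemma frechet_means_bounded (R : realType) (n : nat) (P : {fset torus R n}) :
  P <> fset0 -> dtr_bounded (frechet_means P).
Proof.
move=> /eqP/fset0Pn[p pP].
have [[x0 x0min]|no] := pselect (exists x, frechet_means P x); last first.
  by exists 0 => x y xm; case: no; exists x.
exists (2 * dtr x0 p) => x y; rewrite (frechet_means_balls x0min) /=.
move=> /(_ p pP)/dtr_le xp /(_ p pP)/dtr_le yp; apply/dtr_le => i j.
by have := xp i j; have := yp j i; lra.
Qed.

(** * Existence of a minimizer *)

Lemma max_coord_continuous (R : realType) (n : nat) :
  continuous (@max_coord R n).
Proof.
rewrite /max_coord => v.
elim: (index_enum _) => [|i s IH].
  under eq_fun do rewrite big_nil.
  exact: coord_continuous.
under eq_fun do rewrite big_cons.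
apply: (@continuous_max R 'rV[R]_n.+1 (fun u => u 0 i)) => //.
exact: coord_continuous.
Qed.

Lemma min_coordN (R : realType) (n : nat) (v : 'rV[R]_n.+1) :
  min_coord v = - max_coord (- v).
Proof.
rewrite /max_coord /min_coord (big_morph -%R (@oppr_max R) erefl) mxE opprK.
by apply: eq_bigr => i _; rewrite mxE opprK.
Qed.

Lemma dtr_vec_continuous (R : realType) (n : nat) (u : 'rV[R]_n.+1) :
  continuous (fun v => dtr_vec v u).
Proof.
move=> v; rewrite /dtr_vec; under eq_fun do rewrite min_coordN opprK.
have subC : continuous (fun w : 'rV[R]_n.+1 => w - u).
  by move=> w; exact: (cvgB cvg_id (cvg_cst _)).
have subNC : continuous (fun w : 'rV[R]_n.+1 => - (w - u)).
  by move=> w; exact: (cvgN (subC w)).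
have maxC : continuous (fun w : 'rV[R]_n.+1 => max_coord (w - u)).
  move=> w; apply: continuous_comp; first exact: subC.
  exact: max_coord_continuous.
have minC : continuous (fun w : 'rV[R]_n.+1 => max_coord (- (w - u))).
  move=> w; apply: continuous_comp; first exact: subNC.
  exact: max_coord_continuous.
exact: (cvgD (maxC v) (minC v)).
Qed.

Lemma frechet_cost_continuous (R : realType) (n : nat)
    (P : {fset torus R n}) :
  continuous (fun v => frechet_cost P (\pi_(torus R n) v)).
Proof.
rewrite /frechet_cost.
apply: continuous_big => [|p _]; first exact: add_continuous.
under eq_fun do rewrite dtr_pil expr2.
have c := @dtr_vec_continuous R n (repr p).
by move=> v; exact: (cvgM (c v) (c v)).
Qed.

(** Points are represented with coordinate [0] equal to [0]. The box [K] holds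
    every point within distance [C + 1] of [p], and a point whose cost is at
    most the cost [C] of [p] is that close, because [d ^+ 2 <= C] forces
    [d <= C + 1]. *)
Lemma frechet_means_neq0 (R : realType) (n : nat) (P : {fset torus R n}) :
  P <> fset0 -> frechet_means P !=set0.
Proof.
move=> /eqP/fset0Pn[p pP].
pose C := frechet_cost P p.
pose a i := repr p 0 i - repr p 0 ord0.
pose K := [set v : 'rV[R]_n.+1 |
  forall i, [set` `[a i - (C + 1), a i + (C + 1)]%R] (v 0 i)].
have C0 : 0 <= C by apply: sumr_ge0 => q _; exact: sqr_ge0.
have Ka : K (\row_i a i).
  by move=> i /=; rewrite mxE in_itv /=; apply/andP; split; lra.
have Kcompact : compact K.
  exact: (rV_compact (fun i =>
    @segment_compact R (a i - (C + 1)) (a i + (C + 1)))).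
have [|v vK vmin] := EVT_min_rV (ex_intro _ _ Ka) Kcompact
    (f := fun v => frechet_cost P (\pi_(torus R n) v)).
  exact/continuous_subspaceT/frechet_cost_continuous.
have vC : frechet_cost P (\pi_(torus R n) v) <= C.
  have := vmin _ (mem_set Ka); congr (_ <= frechet_cost P _).
  rewrite -[RHS]reprK; apply/torus_piP; exists (- repr p 0 ord0).
  by apply/rowP => i; rewrite !mxE addrC.
exists (\pi_(torus R n) v) => y; have [yC|/ltW] := leP (frechet_cost P y) C;
  last exact: le_trans.
have -> : y = \pi_(torus R n) (\row_i (repr y 0 i - repr y 0 ord0)).
  rewrite -[LHS]reprK; apply/torus_piP; exists (repr y 0 ord0).
  by apply/rowP => i; rewrite !mxE addrC subrK.
apply/vmin/mem_set => i /=; rewrite mxE in_itv /=.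
have ypC : dtr y p <= C + 1.
  have : dtr y p ^+ 2 <= C.
    apply: le_trans yC; rewrite /frechet_cost (big_rem p) //= lerDl.
    by apply: sumr_ge0 => q _; exact: sqr_ge0.
  by have := dtr_ge0 y p; nra.
have := (dtr_le y p _).1 ypC i ord0; have := (dtr_le y p _).1 ypC ord0 i.
by rewrite /a => *; apply/andP; split; lra.
Qed.

Theorem theorem13 (R : realType) (n : nat) (P : {fset torus R n})
    (P_neq0 : P <> fset0) :
  polytrope (frechet_means P) /\ dtr_bounded (frechet_means P).
Proof.
split; last exact: frechet_means_bounded.
have [x xmin] := frechet_means_neq0 P_neq0.
have [w wE] := balls_digraph_polyhedron (dtr x) P_neq0.
have meansE : frechet_means P = digraph_polyhedron w.
  by rewrite (frechet_means_balls xmin).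
rewrite meansE; split; last exact: digraph_polyhedron_classical_polytope.
by apply: digraph_polyhedron_tropical_polytope; exists x; rewrite -meansE.
Qed.
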